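(* Let $G$ be a finitely presented group. Then the following are equivalent: 1. some finite index subgroup of $G$ has infinite abelianisation; 2. there exists an infinite sequence $G_1 \geq G_2 \geq \dots$ of finite index subgroups of $G$, each normal in $G_1$, such that (i) $G_i/G_{i+1}$ is abelian for all $i \geq 1$; (ii) $\lim_{i \rightarrow \infty} \dfrac{\log [G_i : G_{i+1}]}{[G:G_i]} = \infty$.
   Context: The subgroup $G_1$ is not required to be normal in $G$. *)

(* Defs.v *)
From HB Require Import structures.
From mathcomp Require Import all_boot all_order all_algebra.
From mathcomp Require Import finmap.
From mathcomp Require Import all_classical all_reals all_analysis.

Set Implicit Arguments.
Unset Strict Implicit.
Unset Printing Implicit Defensive.

Import Order.TTheory GRing.Theory Num.Theory.
Import numFieldNormedType.Exports.

Local Open Scope classical_set_scope.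
Local Open Scope group_scope.

(* The letter (i, false) stands for the generator x_i, (i, true) for its
   inverse. *)
Definition word (n : nat) := seq ('I_n * bool).

Definition letter_inv (n : nat) (a : 'I_n * bool) : 'I_n * bool :=
  (a.1, ~~ a.2).

(* [pres_eq rels u v]: the words u and v represent the same element of the
   group < x_0, ..., x_(n-1) | rels >, i.e. of the quotient of the free group
   by the normal closure of rels. *)
Inductive pres_eq (n : nat) (rels : seq (word n)) : word n -> word n -> Prop :=
| pres_eq_refl u : pres_eq rels u u
| pres_eq_sym u v : pres_eq rels u v -> pres_eq rels v u
| pres_eq_trans u v w :
    pres_eq rels u v -> pres_eq rels v w -> pres_eq rels u w
| pres_eq_cat u u' v v' :
    pres_eq rels u u' -> pres_eq rels v v' -> pres_eq rels (u ++ v) (u' ++ v')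
| pres_eq_cancel a : pres_eq rels [:: a; letter_inv a] [::]
| pres_eq_rel r : r \in rels -> pres_eq rels r [::].

Definition word_eval (G : groupType) (n : nat) (g : 'I_n -> G) (w : word n)
    : G :=
  \prod_(a <- w) (if a.2 then (g a.1)^-1 else g a.1).

(* The map x_i |-> g i induces an isomorphism from
   < x_0, ..., x_(n-1) | rels > onto G. *)
Definition finitely_presented (G : groupType) : Prop :=
  exists (n : nat) (rels : seq (word n)) (g : 'I_n -> G),
    (forall x : G, exists w : word n, word_eval g w = x) /\
    (forall u v : word n,
       word_eval g u = word_eval g v <-> pres_eq rels u v).

Definition subgroup (G : groupType) (H : set G) : Prop :=
  group_closed [in H].

Definition left_coset (G : groupType) (x : G) (N : set G) : set G :=
  [set x * y | y in N].

(* The set H/N of left cosets; it is the quotient group when N is a normal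
   subgroup of H. *)
Definition left_cosets (G : groupType) (H N : set G) : set (set G) :=
  [set left_coset x N | x in H].

Definition finite_index (G : groupType) (H K : set G) : Prop :=
  finite_set (left_cosets H K).

(* Meaningful only when finite_index H K holds (0 otherwise). *)
Definition subgroup_index (G : groupType) (H K : set G) : nat :=
  #|` fset_set (left_cosets H K)|.

Definition finite_index_subgroup (G : groupType) (H : set G) : Prop :=
  subgroup H /\ finite_index [set: G] H.

Definition normal_in (G : groupType) (N H : set G) : Prop :=
  N `<=` H /\ (forall x h, N x -> H h -> N (x ^ h)).

Definition set_mul (G : groupType) (A B : set G) : set G :=
  [set x * y | x in A & y in B].

Definition abelian_quotient (G : groupType) (H N : set G) : Prop :=
  forall A B, left_cosets H N A -> left_cosets H N B ->
    set_mul A B = set_mul B A.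

Definition derived_subgroup (G : groupType) (H : set G) : set G :=
  smallest (@subgroup G) [set [~ x, y] | x in H & y in H].

Definition infinite_abelianisation (G : groupType) (H : set G) : Prop :=
  infinite_set (left_cosets H (derived_subgroup H)).

(* Main.v *)
Require Import Defs.
From HB Require Import structures.
From mathcomp Require Import all_boot all_order all_algebra.
From mathcomp Require Import finmap ring zify.
From mathcomp Require Import all_classical all_reals all_analysis.
Import Order.TTheory GRing.Theory Num.Theory.
Import numFieldNormedType.Exports.
Local Open Scope classical_set_scope.
Local Open Scope ring_scope.

(* Let H have index N in G.  Lifting words to paths in the Schreier graph of H
   embeds the abelianisation of H into Z^E / B, where E is the set of N * d edges
   (d the number of generators) and B is spanned by the lifts of the relators.
   If some element of H is not torsion modulo B, a linear functional killing B
   but not this element gives a nonzero homomorphism f : H -> Z.  Otherwise each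
   element has a representative in Z^E which is a combination of the lifted
   relators with rational coefficients in [0, 1[; since all the lifts together
   run through each edge at most L times, L being the total length of the
   relators, its entries are at most L in absolute value, so that the
   abelianisation of H has at most (2L+1)^(N d) elements.
   Hence, if (ii) holds, a homomorphism f exists on some G_i.  Conversely,
   given f and h with f h <> 0, the subgroups f^-1(m (f h) Z) with m growing fast
   enough form the required sequence. *)

(** * Cosets and indices of subgroups *)

Section Cosets.
Set Implicit Arguments.
Unset Strict Implicit.
Variable G : groupType.
Implicit Types (H N K : set G) (x y : G).

Lemma subgroupP H : H 1%g -> (forall x y, H x -> H y -> H (x * y^-1)%g) ->
  subgroup H.
Proof.
move=> H1 HD; split; first by rewrite inE.
by move=> x y; rewrite !inE; apply: HD.
Qed.

Lemma subgroup1 H : subgroup H -> H 1%g.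
Proof. by case; rewrite inE. Qed.

Lemma subgroupV H x : subgroup H -> H x -> H (x^-1)%g.
Proof. by move=> /group_closedV HV Hx; have := HV x; rewrite !inE; exact. Qed.

Lemma subgroupM H x y : subgroup H -> H x -> H y -> H (x * y)%g.
Proof.
by move=> /group_closedM HM Hx Hy; have := HM x y; rewrite !inE; exact.
Qed.

Lemma left_coset_mem N x y : left_coset x N y <-> N (x^-1 * y)%g.
Proof.
split=> [[z Nz <-]|Nxy]; first by rewrite mulKg.
by exists (x^-1 * y)%g => //; rewrite mulVKg.
Qed.

Lemma left_coset_eq N x y : subgroup N ->
  left_coset x N = left_coset y N <-> N (x^-1 * y)%g.
Proof.
move=> sN; split=> [e|Nxy].
  apply/left_coset_mem; rewrite e; apply/left_coset_mem.
  by rewrite mulVg; apply: subgroup1.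
apply/seteqP; split=> z /left_coset_mem Nz; apply/left_coset_mem.
  have -> : (y^-1 * z = (x^-1 * y)^-1 * (x^-1 * z))%g.
    by rewrite invgM invgK mulgA mulgK.
  by apply: subgroupM => //; apply: subgroupV.
have -> : (x^-1 * z = (x^-1 * y) * (y^-1 * z))%g by rewrite mulgA mulgK.
exact: subgroupM.
Qed.

Lemma derived_subgroup_subgroup H : subgroup (derived_subgroup H).
Proof.
apply: subgroupP => [|x y Hx Hy] M MP.
  by case: MP => sM _; apply: subgroup1.
have [sM _] := MP; apply: subgroupM => //; first exact: Hx.
by apply: subgroupV => //; apply: Hy.
Qed.

Lemma derived_subgroup_comm H x y : H x -> H y -> derived_subgroup H [~ x, y]%g.
Proof. by move=> Hx Hy M [_ sub]; apply: sub; exists x => //; exists y. Qed.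

Lemma derived_subgroup_min H N : subgroup N ->
  (forall x y, H x -> H y -> N [~ x, y]%g) -> derived_subgroup H `<=` N.
Proof.
move=> sN HN; apply: smallest_sub => // _ [x Hx] [y Hy] <-.
exact: HN.
Qed.

Lemma derived_subgroup_sub H : subgroup H -> derived_subgroup H `<=` H.
Proof.
move=> sH; apply: derived_subgroup_min => // x y Hx Hy.
by rewrite commgEl; do !apply: subgroupM => //; apply: subgroupV.
Qed.

(** Choosing one element of [H] for each value that [F] takes on [H] already reaches every coset of
    [N]. *)
Lemma finite_index_le (T : finType) (F : G -> T) H N : subgroup N ->
  (forall x y, H x -> H y -> F x = F y -> N (x^-1 * y)%g) ->
  finite_index H N /\ (subgroup_index H N <= #|T|)%N.
Proof.
move=> sN FN.
pose rep k := left_coset (xget 1%g [set x | H x /\ F x = k]) N.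
have sub : left_cosets H N `<=` rep @` [set: T].
  move=> _ [x Hx <-]; exists (F x) => //; apply/left_coset_eq => //.
  by case: xgetP => [y -> [Hy]|/(_ x)]; [exact: FN|case].
have fin : finite_set (left_cosets H N).
  exact/(sub_finite_set sub)/finite_image/finite_finset.
split => //; rewrite /subgroup_index.
have le : (fset_set (left_cosets H N) `<=` [fset rep k | k in T])%fset.
  apply/fsubsetP => A; rewrite in_fset_set // inE => /sub [k _ <-].
  by apply/imfsetP; exists k.
apply: leq_trans (fsubset_leq_card le) _.
by rewrite (leq_trans (leq_imfset_card _ _ _)) // cardE.
Qed.

Lemma subgroup_index_ge (h : nat -> G) q H N : subgroup N ->
  finite_index H N -> (forall j, H (h j)) ->
  (forall j k, (j < q)%N -> (k < q)%N -> N ((h j)^-1 * h k)%g -> j = k) ->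
  (q <= subgroup_index H N)%N.
Proof.
move=> sN fin Hh inj; rewrite /subgroup_index cardfE.
pose s := [seq left_coset (h j) N | j <- iota 0 q].
have us : uniq s.
  rewrite map_inj_in_uniq ?iota_uniq // => j k.
  by rewrite !mem_iota => jq kq /left_coset_eq => /(_ sN); exact: inj.
have -> : q = size s by rewrite size_map size_iota.
rewrite -cardfE; apply: uniq_leq_size => // A /mapP[j _ ->].
by rewrite in_fset_set // inE; exists (h j).
Qed.

Lemma subgroup_index_gt0 H N : subgroup H -> subgroup N -> finite_index H N ->
  (0 < subgroup_index H N)%N.
Proof.
move=> sH sN fin; apply: (@subgroup_index_ge (fun=> 1%g)) => // [_|].
  exact: subgroup1.
by move=> [|//] [|//].
Qed.

Lemma infinite_index (h : nat -> G) H N : subgroup N ->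
  (forall j, H (h j)) -> (forall j k, N ((h j)^-1 * h k)%g -> j = k) ->
  ~ finite_index H N.
Proof.
move=> sN Hh inj fin.
have := @subgroup_index_ge h (subgroup_index H N).+1 H N sN fin Hh.
by rewrite ltnn => /(_ (fun j k _ _ => inj j k)).
Qed.

(** Turns the cosets of [H] into a finite type with a transversal [t], so that they can serve as
    vertices of a finite graph and index sums. *)
Lemma coset_space H : finite_index_subgroup H ->
  exists (C : finType) (kap : G -> C) (t : C -> G),
    [/\ #|C| = subgroup_index [set: G] H, cancel t kap
      & forall x y, kap x = kap y <-> H (x^-1 * y)%g].
Proof.
move=> [sH fin].
have cK x : left_coset x H \in fset_set (left_cosets [set: G] H).
  by rewrite in_fset_set // inE; exists x.
pose kap x : fset_set (left_cosets [set: G] H) := [` cK x]%fset.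
have kapP x y : kap x = kap y <-> H (x^-1 * y)%g.
  rewrite -left_coset_eq //; split=> [/(congr1 val)//|e].
  exact: val_inj.
exists (fset_set (left_cosets [set: G] H)), kap,
  (fun c => xget 1%g [set x | kap x = c]).
split => [|c|//]; first by rewrite -cardfE.
have : (val c) \in fset_set (left_cosets [set: G] H) by exact: valP.
rewrite in_fset_set // inE => -[x _ cx].
by case: xgetP => [y -> //|/(_ x) /=]; case; exact: val_inj.
Qed.

End Cosets.

(** * The abelianisation of a subgroup as an additive group *)

Section Abelianisation.
Set Implicit Arguments.
Unset Strict Implicit.
Variables (G : groupType) (H : set G) (sH : subgroup H).
Let D := derived_subgroup H.
Let sD : subgroup D := derived_subgroup_subgroup H.

(** The proof that [H] is a subgroup is an argument of the type because the group structure declared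
    on it below depends on that proof. *)
Definition abelianisation (_ : subgroup H) : Type :=
  {A : set G | A \in left_cosets H D}.
HB.instance Definition _ := Choice.on (abelianisation sH).

Let unit_coset_in : left_coset 1%g D \in left_cosets H D.
Proof. by rewrite inE; exists 1%g => //; apply: subgroup1. Qed.

(** Outside [H] the value is a default, the trivial coset. *)
Definition abelianised (x : G) : abelianisation sH :=
  insubd (exist _ (left_coset 1%g D) unit_coset_in : abelianisation sH) (left_coset x D).

Let val_abelianised x : H x -> sval (abelianised x) = left_coset x D.
Proof. by move=> Hx; apply: (insubdK (_ : abelianisation sH)); rewrite inE; exists x. Qed.

Lemma abelianised_eq x y : H x -> H y ->
  abelianised x = abelianised y <-> D (x^-1 * y)%g.
Proof.
move=> Hx Hy; rewrite -left_coset_eq // -!val_abelianised //.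
by split=> [->//|/val_inj].
Qed.

Let rep (A : abelianisation sH) : G :=
  xget 1%g [set x | H x /\ abelianised x = A].

Let repP A : H (rep A) /\ abelianised (rep A) = A.
Proof.
rewrite /rep; case: xgetP => [y -> //|].
have := valP A; rewrite inE => -[x Hx xA] /(_ x) []; split => //.
by apply: val_inj; rewrite -xA -(val_abelianised Hx).
Qed.

Let add (A B : abelianisation sH) := abelianised (rep A * rep B)%g.
Let opp (A : abelianisation sH) := abelianised (rep A)^-1%g.

Let derived_conj d y : D d -> H y -> D (y^-1 * (d * y))%g.
Proof.
move=> Dd Hy; have -> : (y^-1 * (d * y) = d * [~ d, y])%g.
  by rewrite commgEl mulVKg.
apply: (subgroupM sD) => //; apply: derived_subgroup_comm => //.
exact: (derived_subgroup_sub sH).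
Qed.

Let addE x y : H x -> H y ->
  add (abelianised x) (abelianised y) = abelianised (x * y)%g.
Proof.
move=> Hx Hy; have [Hx' ex] := repP (abelianised x).
have [Hy' ey] := repP (abelianised y); rewrite /add.
set x' := rep (abelianised x) in Hx' ex *.
set y' := rep (abelianised y) in Hy' ey *.
apply/abelianised_eq; [exact: subgroupM|exact: subgroupM|].
have -> : ((x' * y')^-1 * (x * y)
    = (y'^-1 * y) * (y^-1 * ((x'^-1 * x) * y)))%g.
  by rewrite invgM !mulgA mulgK.
by apply: (subgroupM sD) => //; [|apply: derived_conj => //]; apply/abelianised_eq.
Qed.

Let H1 : H 1%g := subgroup1 sH.

Let addA : associative add.
Proof.
move=> A B C; have [[HA <-] [HB <-] [HC <-]] := And3 (repP A) (repP B) (repP C).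
by rewrite !addE ?mulgA //; apply: subgroupM.
Qed.

Let addC : commutative add.
Proof.
move=> A B; have [[HA <-] [HB <-]] := (repP A, repP B).
rewrite !addE //; apply/abelianised_eq; try exact: subgroupM.
by rewrite invgM -mulgA -conjgE -commgEl; apply: derived_subgroup_comm.
Qed.

Let add0 : left_id (abelianised 1%g) add.
Proof. by move=> A; have [HA <-] := repP A; rewrite addE // mul1g. Qed.

Let addN : left_inverse (abelianised 1%g) opp add.
Proof.
move=> A; have [HA eA] := repP A; rewrite -[X in add _ X]eA addE ?mulVg //.
exact: subgroupV.
Qed.

HB.instance Definition _ :=
  GRing.isZmodule.Build (abelianisation sH) addA addC add0 addN.

Lemma abelianisedM x y : H x -> H y ->
  abelianised (x * y)%g = abelianised x + abelianised y.
Proof. by move=> Hx Hy; rewrite -addE. Qed.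

Lemma abelianised1 : abelianised 1%g = 0.
Proof. by []. Qed.

Lemma abelianisedV x : H x -> abelianised x^-1%g = - abelianised x.
Proof.
move=> Hx; apply/eqP; rewrite -addr_eq0 -abelianisedM ?mulVg //.
exact: subgroupV.
Qed.

Lemma abelianisedJ x y : H x -> H y -> abelianised (x^-1 * y * x)%g = abelianised y.
Proof.
move=> Hx Hy; have HV := subgroupV sH Hx; rewrite !abelianisedM //.
  by rewrite abelianisedV // addrAC addNr add0r.
exact: subgroupM.
Qed.

End Abelianisation.

(** * Integer combinations of finitely many integer vectors *)

Section IntegerLattices.
Set Implicit Arguments.
Unset Strict Implicit.

Lemma common_denominator (I : finType) (x : I -> rat) :
  exists (m : nat) (a : I -> int),
    (0 < m)%N /\ forall i, x i * m%:R = (a i)%:~R.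
Proof.
exists (\prod_i `|denq (x i)|)%N,
  (fun i => numq (x i) * (\prod_(j | j != i) `|denq (x j)|)%N%:Z).
split=> [|i]; first by rewrite prodn_gt0 // => i; rewrite absz_gt0 denq_neq0.
rewrite (bigD1 i) //= natrM rmorphM /= mulrA; congr (_ * _).
rewrite -[X in X * _]divq_num_den -[(`|_|)%:R]/((`|_|%N%:Z)%:~R).
by rewrite absz_denq mulfVK // intr_eq0 denq_neq0.
Qed.

Definition int_span (I E : finType) (b : I -> E -> int) (v : E -> int) : Prop :=
  exists a : I -> int, forall e, v e = \sum_i a i * b i e.

Lemma int_span0 (I E : finType) (b : I -> E -> int) (v : E -> int) :
  (forall e, v e = 0) -> int_span b v.
Proof. by exists (fun=> 0) => e; rewrite big1 // => i _; rewrite mul0r. Qed.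

Lemma int_spanN (I E : finType) (b : I -> E -> int) (u v : E -> int) :
  int_span b u -> (forall e, v e = - u e) -> int_span b v.
Proof.
move=> [a ua] vE; exists (fun i => - a i) => e; rewrite vE ua -sumrN.
by apply: eq_bigr => i _; rewrite mulNr.
Qed.

Lemma int_spanD (I E : finType) (b : I -> E -> int) (u v w : E -> int) :
  int_span b u -> int_span b v -> (forall e, w e = u e + v e) -> int_span b w.
Proof.
move=> [a ua] [c vc] wE; exists (fun i => a i + c i) => e.
by rewrite wE ua vc -big_split; apply: eq_bigr => i _; rewrite mulrDl.
Qed.

Lemma int_span_mem (I E : finType) (b : I -> E -> int) (i : I) :
  int_span b (b i).
Proof.
exists (fun j => (j == i)%:R) => e; rewrite (bigD1 i) //= eqxx mul1r.
by rewrite big1 ?addr0 // => j /negPf ->; rewrite mul0r.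
Qed.

(** Linear algebra over the rationals: if [v] lies in the row space of [b], clearing denominators
    gives [m]; otherwise some column of the cokernel matrix kills [b] but not [v], and clearing its
    denominators gives [phi]. *)
Lemma int_span_dichotomy (I E : finType) (b : I -> E -> int) (v : E -> int) :
  (exists m : nat, (0 < m)%N /\ int_span b (fun e => v e *+ m)) \/
  (exists phi : E -> int,
     (forall i, \sum_e b i e * phi e = 0) /\ \sum_e v e * phi e != 0).
Proof.
pose B : 'M[rat]_(#|I|, #|E|) :=
  \matrix_(i, j) (b (enum_val i) (enum_val j))%:~R.
pose V : 'rV[rat]_#|E| := \row_j (v (enum_val j))%:~R.
have [/submxP[x xB]|] := boolP (V <= B)%MS.
  left; have [m [a [m0 am]]] := common_denominator (fun i => x 0 (enum_rank i)).
  exists m; split=> //; exists a => e; apply: (@intr_inj rat).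
  have /rowP/(_ (enum_rank e)) := xB; rewrite !mxE enum_rankK => ve.
  rewrite -mulr_natr rmorphM rmorph_nat /= ve mulr_suml rmorph_sum (reindex enum_rank) /=.
    apply: eq_bigr => i _; rewrite mxE !enum_rankK mulrAC rmorphM.
    by congr (_ * _); exact: am.
  by apply: onW_bij; exact: enum_rank_bij.
rewrite submxE => nz; right.
have [k Vk] : exists k, (V *m cokermx B) 0 k != 0.
  apply/existsP; apply: contraR nz => /existsPn z; apply/eqP/rowP => k.
  by rewrite [RHS]mxE; apply/eqP/negPn/z.
have [m [phi [m0 mphi]]] :=
  common_denominator (fun e => cokermx B (enum_rank e) k).
have sumE (w : E -> int) : ((\sum_e w e * phi e)%:~R : rat) =
    ((\row_j (w (enum_val j))%:~R) *m cokermx B) 0 k * m%:R.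
  rewrite rmorph_sum mxE mulr_suml (reindex (enum_val : 'I_#|E| -> E)) /=; last first.
    by apply: onW_bij; exact: enum_val_bij.
  apply: eq_bigr => j _; rewrite rmorphM mxE -mulrA; congr (_ * _).
  by have := mphi (enum_val j); rewrite enum_valK => ->.
exists phi; split=> [i|]; last first.
  by rewrite -(intr_eq0 rat) sumE mulf_neq0 // pnatr_eq0 -lt0n.
apply: (@intr_inj rat); rewrite sumE.
have -> : \row_j (b i (enum_val j))%:~R = row (enum_rank i) B.
  by apply/rowP => j; rewrite !mxE enum_rankK.
by rewrite -row_mul mulmx_coker !mxE mul0r.
Qed.

(* Reducing the coefficients of the relation [v *+ m] modulo [m] leaves a
   vector whose [m]-th multiple has coefficients in [0, m). *)
Lemma torsion_reduce (I E : finType) (b : I -> E -> int) (v : E -> int)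
    (m L : nat) : (0 < m)%N ->
  int_span b (fun e => v e *+ m) ->
  (forall e, \sum_i `|b i e| <= L%:Z) ->
  exists u : E -> int,
    (forall e, `|u e| <= L%:Z) /\ int_span b (fun e => v e - u e).
Proof.
move=> m0 [a va] bL; have m0' : 0 < m%:Z by [].
pose c i := (a i %/ m%:Z)%Z; pose r i := (a i %% m%:Z)%Z.
exists (fun e => v e - \sum_i c i * b i e).
split=> [e|]; last by exists c => e; rewrite subKr.
rewrite -(ler_pM2l m0').
have -> : m%:Z * `|v e - \sum_i c i * b i e| = `|\sum_i r i * b i e|.
  rewrite -[X in X * _]gtr0_norm // -normrM mulrBr.
  rewrite [m%:Z * v e]mulrC -{1}[m%:Z]natz mulr_natr va mulr_sumr.
  rewrite -sumrB; congr `|_|; apply: eq_bigr => i _.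
  by rewrite [a i](divz_eq _ m%:Z) -/(c i) -/(r i); ring.
apply: le_trans (ler_norm_sum _ _ _) _.
apply: le_trans (_ : \sum_i m%:Z * `|b i e| <= _); last first.
  by rewrite -mulr_sumr ler_pM2l.
apply: ler_sum => i _; rewrite normrM ler_wpM2r // ger0_norm.
  by apply/ltW/ltz_pmod.
by apply: modz_ge0; rewrite gt_eqF.
Qed.

End IntegerLattices.

(** * Lifting words to the Schreier graph *)

Section SchreierGraph.
Set Implicit Arguments.
Unset Strict Implicit.
Variables (G : groupType) (n : nat) (rels : seq (word n)) (g : 'I_n -> G).
Hypothesis gen : forall x : G, exists w : word n, word_eval g w = x.
Hypothesis pres : forall u v : word n,
  word_eval g u = word_eval g v <-> pres_eq rels u v.
Variables (H : set G) (sH : subgroup H).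
Variables (C : finType) (kap : G -> C) (t : C -> G).
Hypothesis kapK : cancel t kap.
Hypothesis kapP : forall x y, kap x = kap y <-> H (x^-1 * y)%g.

Let letter (a : 'I_n * bool) : G := if a.2 then (g a.1)^-1%g else g a.1.

(* Inverting makes [x], a left translation of the cosets, act on the right, so
   that words are read from left to right; the base point is the coset [H]. *)
Let act (c : C) (x : G) : C := kap (x^-1 * t c)%g.

Let act_kap x y : act (kap x) y = kap (y^-1 * x)%g.
Proof.
apply/kapP; rewrite invgM -mulgA mulKg; apply/kapP.
by rewrite kapK.
Qed.

Let act1 c : act c 1%g = c.
Proof. by rewrite -(kapK c) act_kap invg1 mul1g. Qed.

Let actM c x y : act c (x * y)%g = act (act c x) y.
Proof. by rewrite -(kapK c) !act_kap invgM mulgA. Qed.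

Let actK c x : act (act c x) x^-1%g = c.
Proof. by rewrite -actM mulgV act1. Qed.

Let act_base x : H x -> act (kap 1%g) x = kap 1%g.
Proof. by move=> Hx; rewrite act_kap; apply/kapP; rewrite !mulg1 invgK. Qed.

Let word_eval_cons a w : word_eval g (a :: w) = (letter a * word_eval g w)%g.
Proof. by rewrite /word_eval big_cons. Qed.

Let word_eval_cat u v :
  word_eval g (u ++ v) = (word_eval g u * word_eval g v)%g.
Proof. by rewrite /word_eval big_cat. Qed.

Let letter_invE a : letter (letter_inv a) = (letter a)^-1%g.
Proof. by case: a => i [] //=; rewrite /letter /= invgK. Qed.

(** The pair [(c, i)] is the edge from [c] to [act c (g i)]. An inverse letter read at [c] runs
    backwards through the edge that ends at [c]. *)
Let edge (c : C) (a : 'I_n * bool) : C * 'I_n :=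
  if a.2 then (act c (letter a), a.1) else (c, a.1).

Let sgn (a : 'I_n * bool) : int := if a.2 then -1 else 1.

(* The signed number of times the path labelled [w] from [c] runs through each
   edge of the Schreier graph. *)
Fixpoint lift_chain (c : C) (w : word n) (e : C * 'I_n) : int :=
  if w is a :: w'
  then sgn a * (edge c a == e)%:R + lift_chain (act c (letter a)) w' e else 0.

Lemma lift_chain_cat c u v e : lift_chain c (u ++ v) e =
  lift_chain c u e + lift_chain (act c (word_eval g u)) v e.
Proof.
elim: u c => [|a u IH] c /=; first by rewrite /word_eval big_nil act1 add0r.
by rewrite IH word_eval_cons actM addrA.
Qed.

Lemma lift_chain_cancel c a e : lift_chain c [:: a; letter_inv a] e = 0.
Proof.
rewrite /lift_chain addr0 /sgn /edge letter_invE actK.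
by case: a => i [] /=; rewrite !(mul1r, mulN1r, addNr, subrr).
Qed.

(** Each letter acts on the vertices by a permutation, so for each position in [w] at most one
    starting vertex makes the path run through [e] at that position. *)
Lemma lift_chain_norm w e :
  \sum_c `|lift_chain c w e| <= (size w)%:Z.
Proof.
elim: w => [|a w IH] /=; first by rewrite big1.
apply: le_trans (_ : \sum_c `|sgn a * (edge c a == e)%:R|
   + \sum_c `|lift_chain (act c (letter a)) w e| <= _).
  by rewrite -big_split; apply: ler_sum => c _; exact: ler_normD.
rewrite -add1n PoszD; apply: lerD; last first.
  rewrite (reindex (act^~ (letter a)^-1%g)); last first.
    exists (act^~ (letter a)) => c _ //; first by rewrite -{2}[letter a]invgK actK.
  under eq_bigr => c _ do rewrite -{2}[letter a]invgK actK.
  exact: IH.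
have -> : \sum_c `|sgn a * (edge c a == e)%:R| =
    \sum_(c | edge c a == e) 1%:Z.
  rewrite [RHS]big_mkcond; apply: eq_bigr => c _; rewrite normrM.
  by rewrite /sgn; case: (a.2); case: eqP => _; rewrite ?normrN !normr1 ?normr0.
have inj c d : edge c a = edge d a -> c = d.
  by rewrite /edge; case: (a.2) => -[] // /(congr1 (act^~ (letter a)^-1%g));
     rewrite !actK.
have [/existsP[c /eqP ce]|/existsPn no] := boolP [exists c, edge c a == e].
  rewrite (bigD1 c) ?ce ?eqxx //= big1 // => d /andP[/eqP de] /eqP[].
  by apply: inj; rewrite ce de.
by rewrite big_pred0 // => c; apply/negbTE.
Qed.

(** Every vertex is a starting point, since a relator may be inserted anywhere in a word. *)
Let relator_lift (j : C * 'I_(size rels)) : C * 'I_n -> int :=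
  lift_chain j.1 (nth [::] rels j.2).

Lemma relator_lift_norm e :
  \sum_j `|relator_lift j e| <= (\sum_(k < size rels) size (nth [::] rels k))%:Z.
Proof.
rewrite -(pair_bigA _ (fun c k => `|relator_lift (c, k) e|)) exchange_big /=.
rewrite (big_morph Posz PoszD (erefl _)); apply: ler_sum => k _.
exact: lift_chain_norm.
Qed.

(** The induction treats all starting vertices at once: in a concatenation the second path starts
    where the first one ends, and equivalent words end at the same vertex. *)
Lemma lift_chain_pres u v c : pres_eq rels u v ->
  int_span relator_lift (fun e => lift_chain c u e - lift_chain c v e).
Proof.
move=> uv; elim: uv c => {u v}.
- by move=> u c; apply: int_span0 => e; rewrite subrr.
- by move=> u v _ IH c; apply: int_spanN (IH c) _ => e; rewrite opprB.
- move=> u v w _ IH1 _ IH2 c; apply: int_spanD (IH1 c) (IH2 c) _ => e.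
  by rewrite addrA subrK.
- move=> u u' v v' uu' IH1 _ IH2 c.
  apply: int_spanD (IH1 c) (IH2 (act c (word_eval g u))) _ => e.
  by rewrite !lift_chain_cat (pres u u').2 //; ring.
- by move=> a c; apply: int_span0 => e; rewrite lift_chain_cancel subrr.
move=> r rr c; have k : (index r rels < size rels)%N by rewrite index_mem.
have [a ra] := int_span_mem relator_lift (c, Ordinal k).
by exists a => e; rewrite -ra subr0 /relator_lift /= nth_index.
Qed.

(** For [x] a generator these are the Schreier generators of [H] for the transversal [t]; along a
    path the inner representatives cancel. *)
Let schreier (c : C) (x : G) : G := ((t c)^-1 * x * t (act c x))%g.

Let schreier_in c x : H (schreier c x).
Proof.
have /kapP : kap (x^-1 * t c)%g = kap (t (act c x)) by rewrite kapK.
by rewrite invgM invgK.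
Qed.

Let schreierM c x y :
  schreier c (x * y)%g = (schreier c x * schreier (act c x) y)%g.
Proof. by rewrite /schreier actM !mulgA mulgK. Qed.

(** The homomorphism from the edge lattice to the abelianisation that sends each edge to the class
    of its Schreier generator. *)
Let psi (v : C * 'I_n -> int) : abelianisation sH :=
  \sum_e abelianised sH (schreier e.1 (g e.2)) *~ v e.

Let psi_chain c w :
  psi (lift_chain c w) = abelianised sH (schreier c (word_eval g w)).
Proof.
elim: w c => [|a w IH] c.
  rewrite /word_eval big_nil /schreier act1 mulg1 mulVg abelianised1.
  by rewrite /psi big1 // => e _; rewrite mulr0z.
rewrite word_eval_cons schreierM abelianisedM // -IH /psi /=.
under eq_bigr => e _ do rewrite mulrzDr.
rewrite big_split /=; congr (_ + _).
rewrite (bigD1 (edge c a)) //= big1 ?addr0 => [|e /negPf]; last first.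
  by rewrite eq_sym => ->; rewrite mulr0 mulr0z.
rewrite eqxx mulr1 /sgn /edge /letter; case: (a.2) => //=.
rewrite mulrN1z -abelianisedV //; congr abelianised.
have cK : act (act c (g a.1)^-1%g) (g a.1) = c.
  by rewrite -{2}[g a.1]invgK actK.
by rewrite /schreier cK !invgM invgK !mulgA.
Qed.

(** A relator evaluates to 1, so its lift from [c] is sent to the class of [schreier c 1], which is
    trivial: [psi] factors through the lattice modulo the relator lifts. *)
Let psi_eq u v : int_span relator_lift (fun e => u e - v e) -> psi u = psi v.
Proof.
move=> [a uva]; apply/eqP; rewrite -subr_eq0 /psi -sumrB; apply/eqP.
under eq_bigr => e _ do rewrite -mulrzBr uva mulrz_sumr.
rewrite exchange_big big1 //= => j _.
under eq_bigr => e _ do rewrite mulrC mulrzA.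
rewrite -mulrz_suml -/(psi (relator_lift j)) /relator_lift psi_chain.
have -> : word_eval g (nth [::] rels j.2) = 1%g.
  have <- : word_eval g [::] = 1%g by rewrite /word_eval big_nil.
  by apply/pres/pres_eq_rel/mem_nth.
by rewrite /schreier act1 mulg1 mulVg abelianised1 mul0rz.
Qed.

(** Allowing every [N] above the derived subgroup covers both uses: the derived subgroup itself and
    the next term of a sequence with abelian quotients. *)
Lemma schreier_dichotomy :
  (forall N, subgroup N -> derived_subgroup H `<=` N ->
     finite_index H N /\ (subgroup_index H N <=
       (\sum_(k < size rels) size (nth [::] rels k)).*2.+1 ^ (#|C| * n))%N) \/
  (exists f : G -> int,
     (forall x y, H x -> H y -> f (x * y)%g = f x + f y) /\
     exists2 h, H h & f h != 0).
Proof.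
set L := (\sum_(k < _) _)%N.
have /choice[wd wdE] := gen.
pose ch x := lift_chain (kap 1%g) (wd x).
have [[x Hx tf]|tors] := pselect (exists2 x, H x & ~ exists m : nat, (0 < m)%N /\
    int_span relator_lift (fun e => ch x e *+ m)).
  right; have [//|[phi [phi0 phix]]] := int_span_dichotomy relator_lift (ch x).
  pose dot u := \sum_e u e * phi e.
  have dot_span u v : int_span relator_lift (fun e => u e - v e) -> dot u = dot v.
    move=> [a ua]; apply/eqP; rewrite -subr_eq0 /dot -sumrB; apply/eqP.
    under eq_bigr => e _ do rewrite -mulrBl ua mulr_suml.
    rewrite exchange_big big1 //= => j _.
    under eq_bigr => e _ do rewrite -mulrA.
    by rewrite -mulr_sumr phi0 mulr0.
  exists (fun x => dot (ch x)); split; last by exists x.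
  move=> y z Hy Hz.
  (* The chosen word for [y * z] may be replaced by the concatenation, as both represent the same
     element. Since [y] is in [H], its path is closed and the second path starts at the base point
     again. *)
  rewrite (dot_span _ (lift_chain (kap 1%g) (wd y ++ wd z))).
    rewrite /dot -big_split; apply: eq_bigr => e _.
    by rewrite lift_chain_cat wdE act_base // mulrDl.
  by apply/lift_chain_pres/pres; rewrite word_eval_cat !wdE.
left=> N sN DN.
(* The reduced vector has entries between [-L] and [L]; adding [L] puts them among the [2L+1] values
   of the ordinal type. *)
have box x : exists u : {ffun C * 'I_n -> 'I_L.*2.+1}, H x ->
    int_span relator_lift (fun e => ch x e - ((u e)%:Z - L%:Z)).
  have [Hx|nHx] := pselect (H x); last by exists [ffun=> ord0] => /nHx.
  have [[m [m0 mB]]|/(_ _)] := pselect (exists m : nat, (0 < m)%N /\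
    int_span relator_lift (fun e => ch x e *+ m)); last by move=> nt; case: tors; exists x.
  have [v [vL vB]] := torsion_reduce m0 mB relator_lift_norm.
  exists [ffun e => inord (absz (v e + L%:Z))] => _.
  have [a va] := vB; exists a => e; rewrite -va; congr (_ - _).
  have /ler_normlP[v1 v2] := vL e.
  rewrite ffunE inordK; last by rewrite ltnS; lia.
  by rewrite gez0_abs ?addrK //; lia.
have /choice[F FB] := box.
have [x y Hx Hy Fxy|fin le] := finite_index_le (F := F) (H := H) sN.
  apply/DN/(abelianised_eq sH) => //.
  have : psi (ch x) = psi (ch y).
    apply: psi_eq; apply: int_spanD (FB x Hx) (int_spanN (FB y Hy) (fun=> erefl)) _.
    by move=> e; rewrite Fxy; ring.
  (* The representative of the base coset need not be 1, but it lies in [H], so conjugation by it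
     disappears in the abelianisation. *)
  have H1 : H (t (kap 1%g)).
    by have /kapP : kap 1%g = kap (t (kap 1%g)); rewrite ?kapK // invg1 mul1g.
  by rewrite /ch !psi_chain !wdE /schreier !act_base // !abelianisedJ.
split=> //; apply: leq_trans le _.
by rewrite card_ffun card_ord card_prod card_ord.
Qed.

End SchreierGraph.

(** [K] and [d] come from the presentation alone, hence are the same for all [H]; only the number of
    vertices of the graph varies. *)
Lemma abelianisation_dichotomy (G : groupType) : finitely_presented G ->
  exists K d : nat, (0 < K)%N /\ forall H : set G, finite_index_subgroup H ->
    (forall N, subgroup N -> derived_subgroup H `<=` N ->
       finite_index H N /\
       (subgroup_index H N <= K ^ (subgroup_index [set: G] H * d))%N) \/
    (exists f : G -> int,
       (forall x y, H x -> H y -> f (x * y)%g = f x + f y) /\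
       exists2 h, H h & f h != 0).
Proof.
move=> [n [rels [g [gen pres]]]].
exists (\sum_(k < size rels) size (nth [::] rels k))%N.*2.+1, n; split=> // H iH.
have [C [kap [t [<- kapK kapP]]]] := coset_space iH.
exact: (schreier_dichotomy gen pres iH.1 kapK kapP).
Qed.

(** * Subgroups cut out by a homomorphism to the integers *)

Section IntegerHom.
Set Implicit Arguments.
Unset Strict Implicit.
Variables (G : groupType) (H : set G) (f : G -> int).
Hypothesis sH : subgroup H.
Hypothesis fM : forall x y, H x -> H y -> f (x * y)%g = f x + f y.

Let f1 : f 1%g = 0.
Proof.
have H1 := subgroup1 sH; apply: (addIr (f 1%g)).
by rewrite -fM // mul1g add0r.
Qed.

Let fV x : H x -> f x^-1%g = - f x.
Proof.
move=> Hx; have HV := subgroupV sH Hx.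
by apply/eqP; rewrite -addr_eq0 -fM // mulVg f1.
Qed.

Let subgroupX x k : H x -> H (x ^+ k)%g.
Proof.
move=> Hx; elim: k => [|k IH]; first exact: subgroup1.
by rewrite expgS; apply: subgroupM.
Qed.

Let fX x k : H x -> f (x ^+ k)%g = f x *+ k.
Proof.
move=> Hx; elim: k => [|k IH]; first by rewrite mulr0n f1.
by rewrite expgS mulrS fM ?IH //; apply: subgroupX.
Qed.

(** The derived subgroup lies in the kernel of [f], while [f] separates the powers of [h]. *)
Lemma hom_infinite_abelianisation h : H h -> f h != 0 ->
  infinite_abelianisation H.
Proof.
move=> Hh fh0; have kerD x : derived_subgroup H x -> H x /\ f x = 0.
  suff : derived_subgroup H `<=` [set x | H x /\ f x = 0] by exact.
  apply: derived_subgroup_min => [|y z Hy Hz] /=.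
    apply: subgroupP => [|y z [Hy fy] [Hz fz]] /=.
      by split=> //; exact: subgroup1.
    have HV := subgroupV sH Hz.
    by split; [exact: subgroupM|rewrite fM // fV // fy fz oppr0].
  have [HVy HVz] := (subgroupV sH Hy, subgroupV sH Hz).
  have HM u v := @subgroupM G H u v sH; have HVzyz : H (z^-1 * (y * z))%g by auto.
  split; first by rewrite commgEl; auto.
  by rewrite commgEl conjgE !fM ?fV; auto; ring.
apply: (@infinite_index _ (fun k => h ^+ k)%g).
- exact: derived_subgroup_subgroup.
- by move=> k; apply: subgroupX.
move=> j k /kerD[_]; have Hj := subgroupX j Hh; have Hk := subgroupX k Hh.
rewrite fM //; last exact: subgroupV.
rewrite fV // !fX // => /eqP; rewrite addrC subr_eq0.
rewrite -(mulr_natr _ j) -(mulr_natr _ k) => /eqP.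
by move/(mulfI fh0)/eqP; rewrite eqr_nat => /eqP.
Qed.

Definition hom_level (d : int) : set G := [set x | H x /\ (d %| f x)%Z].

Lemma hom_level_subgroup d : subgroup (hom_level d).
Proof.
apply: subgroupP => [|x y [Hx dx] [Hy dy]].
  by split; [exact: subgroup1|rewrite f1 dvdz0].
have HV := subgroupV sH Hy; split; first exact: subgroupM.
by rewrite fM // fV // rpredB.
Qed.

Lemma hom_level_finite_index d : finite_index [set: G] H -> d != 0 ->
  finite_index_subgroup (hom_level d).
Proof.
move=> fin d0; have [C [kap [t [_ kapK kapP]]]] := coset_space (conj sH fin).
have Ht x : H ((t (kap x))^-1 * x)%g by apply/kapP.
have sK := hom_level_subgroup d; split => //.
(* The coset of [x] modulo [H], together with the residue modulo [d] of [f] at the [H]-part of [x],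
   determines the coset modulo [hom_level d]. *)
pose F x : C * 'I_`|d|%N.+1 := (kap x, inord `|(f ((t (kap x))^-1 * x)%g %% d)%Z|%N).
apply: (proj1 (finite_index_le (F := F) sK _)) => x y _ _ [kxy].
have bnd z : (`|(z %% d)%Z| < `|d|.+1)%N.
  have := ltz_mod z d0; have := modz_ge0 z d0; lia.
move/(congr1 val); rewrite /= !inordK // => e.
have Hxy : H (x^-1 * y)%g by apply/kapP.
split => //.
have -> : (x^-1 * y = ((t (kap x))^-1 * x)^-1 * ((t (kap y))^-1 * y))%g.
  by rewrite kxy invgM invgK -mulgA mulVKg.
rewrite fM ?fV //; last exact: subgroupV.
rewrite addrC -eqz_mod_dvd; apply/eqP.
rewrite -[LHS]gez0_abs ?modz_ge0 // -[RHS]gez0_abs ?modz_ge0 //.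
by rewrite e.
Qed.

Lemma hom_level_sub d e : (d %| e)%Z -> hom_level e `<=` hom_level d.
Proof. by move=> de x [Hx ex]; split=> //; apply: dvdz_trans ex. Qed.

Lemma hom_level_normal d K : K `<=` H -> hom_level d `<=` K ->
  normal_in (hom_level d) K.
Proof.
move=> KH dK; split => // x y [Hx dx] /KH Hy; have HV := subgroupV sH Hy.
have Hxy : H (x * y)%g by exact: subgroupM.
split; first by rewrite conjgE; apply: subgroupM.
by rewrite conjgE !fM ?fV // [f x + _]addrC addKr.
Qed.

Lemma hom_level_abelian d K : K `<=` H -> abelian_quotient K (hom_level d).
Proof.
move=> KH.
have sub x y : H x -> H y -> set_mul (left_coset x (hom_level d))
    (left_coset y (hom_level d)) `<=`
    set_mul (left_coset y (hom_level d)) (left_coset x (hom_level d)).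
  move=> Hx Hy _ [_ [u [Hu du] <-] [_ [v [Hv dv] <-] <-]].
  have [HVx HVy] := (subgroupV sH Hx, subgroupV sH Hy).
  have HM a b := @subgroupM G H a b sH.
  exists y; first by exists 1%g; [exact: subgroup1 (hom_level_subgroup d)|rewrite mulg1].
  exists (y^-1 * (x * u * (y * v)))%g; last by rewrite mulVKg.
  exists (x^-1 * (y^-1 * (x * u * (y * v))))%g; last by rewrite mulVKg.
  split; first by auto 10.
  rewrite !fM ?fV; auto 10.
  have -> : - f x + (- f y + (f x + f u + (f y + f v))) = f u + f v by ring.
  by rewrite rpredD.
by move=> _ _ [x /KH Hx <-] [y /KH Hy <-]; apply/seteqP; split; exact: sub.
Qed.

(** The powers [h ^+ (m * j)] with [j < q] lie in the larger subgroup, and their values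
    [m * j * f h] are distinct modulo [m * q * f h]. *)
Lemma hom_level_index h (m q : nat) : H h -> f h != 0 -> (0 < m)%N ->
  finite_index (hom_level (m%:Z * f h)) (hom_level ((m * q)%N%:Z * f h)) ->
  (q <= subgroup_index (hom_level (m%:Z * f h))
          (hom_level ((m * q)%N%:Z * f h)))%N.
Proof.
move=> Hh fh0 m0 fin.
apply: (@subgroup_index_ge _ (fun j => h ^+ (m * j))%g) => //.
- exact: hom_level_subgroup.
- move=> j; split; first exact: subgroupX.
  by rewrite fX // -mulr_natl natz PoszM mulrAC dvdz_mulr.
move=> j k jq kq [_]; have [Hj Hk] := (subgroupX (m * j) Hh, subgroupX (m * k) Hh).
rewrite fM ?fV //; last exact: subgroupV.
rewrite !fX // -(mulr_natl _ (m * j)) -(mulr_natl _ (m * k)) !natz !PoszM -mulNr -mulrDl dvdz_mul2r //.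
rewrite -mulrN -mulrDr dvdz_mul2l; last by rewrite -lt0n.
rewrite addrC -eqz_mod_dvd !modz_small ?lez_nat ?ltz_nat ?jq ?kq //.
by rewrite eqz_nat => /eqP.
Qed.

End IntegerHom.

(** * The equivalence *)

Theorem theorem1p5 (R : realType) (G : groupType) (hG : finitely_presented G) :
  (exists H : set G, finite_index_subgroup H /\ infinite_abelianisation H)
  <->
  (exists G_ : nat -> set G,
     [/\ (forall i, (1 <= i)%N -> finite_index_subgroup (G_ i)),
         (forall i, (1 <= i)%N -> G_ i.+1 `<=` G_ i),
         (forall i, (1 <= i)%N -> normal_in (G_ i) (G_ 1%N)),
         (forall i, (1 <= i)%N -> abelian_quotient (G_ i) (G_ i.+1)) &
         (ln ((subgroup_index (G_ i) (G_ i.+1))%:R : R)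
            / (subgroup_index [set: G] (G_ i))%:R) @[i --> \oo] --> +oo]).
Proof.
have [K [d [K0 dich]]] := abelianisation_dichotomy hG.
have sT : subgroup [set: G] by exact: subgroupP.
split=> [[H [iH infH]]|[G_ [iG sub nor ab lim]]]; last first.
  apply: contrapT => noH.
  have bound i : (1 <= i)%N -> (subgroup_index (G_ i) (G_ i.+1) <=
      K ^ (subgroup_index [set: G] (G_ i) * d))%N.
    move=> i1; have [sG _] := iG i i1; have [sG' _] := iG i.+1 isT.
    have [le|[f [fM [h Gh fh0]]]] := dich _ (iG i i1); last first.
      case: noH; exists (G_ i); split; first exact: iG.
      exact: hom_infinite_abelianisation fM h Gh fh0.
    apply: (le _ sG' _).2; apply: derived_subgroup_min => // x y Gx Gy.
    have G1 : G_ i.+1 1%g by exact: subgroup1.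
    (* Commuting cosets give [x * y = y * u * (x * v)] with [u] and [v] in [G_ i.+1], so the
       commutator is [u ^ x * v]. It lies in [G_ i.+1] because [x] is in [G_ 1] and [G_ i.+1] is
       normal there. *)
    have : set_mul (left_coset y (G_ i.+1)) (left_coset x (G_ i.+1)) (x * y)%g.
      rewrite -(ab i i1 (left_coset x _)); first exists x; [| |exists x|exists y] => //.
        by exists 1%g; rewrite ?mulg1.
      by exists y => //; exists 1%g; rewrite ?mulg1.
    move=> [_ [u Nu <-] [_ [v Nv <-] e]].
    have -> : [~ x, y]%g = (u ^ x * v)%g.
      apply: (mulgI (y * x)%g); rewrite -commgC -e conjgE.
      by rewrite !mulgA mulgK.
    apply: subgroupM => //; apply: (nor i.+1 isT).2 => //.
    have sub1 : forall k, G_ k.+1 `<=` G_ 1%N.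
      by elim=> // k IH; apply: subset_trans IH; apply: sub.
    by move: Gx; case: (i) i1 => // k _; apply: sub1.
  (* By [bound] the ratio never exceeds [d * ln K] for [i >= 1], so a single index where it does is
     a contradiction; the maximum with 1 keeps the hypotheses on [G_ i] available. *)
  move/cvgryPgt/(_ (d%:R * ln K%:R)) : lim => -[i0 _ /(_ (maxn 1 i0))].
  rewrite /= leq_maxr => /(_ isT); set i := maxn 1 i0.
  have i1 : (1 <= i)%N by rewrite leq_maxl.
  have [sG fG] := iG i i1; have [sG' fG'] := iG i.+1 isT.
  have N0 := subgroup_index_gt0 sT sG fG.
  rewrite ltr_pdivlMr ?ltr0n // ltNge => /negP; apply.
  (* For index 0, the default value, [ln 0 = 0] makes the inequality immediate. *)
  have [->|ind0] := posnP (subgroup_index (G_ i) (G_ i.+1)).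
    by rewrite ln0 // !mulr_ge0 // ln_ge0 // ler1n.
  apply: le_trans (_ : ln (K ^ (subgroup_index [set: G] (G_ i) * d))%:R <= _).
    by rewrite ler_ln ?posrE ?ltr0n ?expn_gt0 ?K0 // ler_nat bound.
  by rewrite natrX lnXn ?ltr0n // -(mulr_natl (ln _)) natrM -mulrA mulrC.
have [sH fH] := iH.
have [le|[f [fM [h Hh fh0]]]] := dich _ iH.
  by case: infH; apply: (le _ (derived_subgroup_subgroup H) _).1.
pose lev (m : nat) := hom_level H f (m%:Z * f h).
have levF m : (0 < m)%N -> finite_index_subgroup (lev m).
  move=> m0; apply: hom_level_finite_index => //.
  by rewrite mulf_neq0 // -lt0n.
have levS (m q : nat) : lev (m * q)%N `<=` lev m.
  by apply: hom_level_sub; rewrite PoszM mulrAC dvdz_mulr.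
have levH m : lev m `<=` H by move=> x [].
(* If [lev m] has index [N] in [G], the next step has index at least [q i m = 2 ^ (i * N)], so the
   logarithm divided by [N] is at least [i * ln 2]. *)
pose q i m := (2 ^ (i * subgroup_index [set: G] (lev m)))%N.
pose fix ms i := if i is i'.+1 then (ms i' * q i' (ms i'))%N else 1%N.
have ms0 i : (0 < ms i)%N by elim: i => //= i IH; rewrite muln_gt0 IH expn_gt0.
have msE i : ms i.+1 = (ms i * q i (ms i))%N by [].
exists (fun i => lev (ms i)); split.
- by move=> i _; apply: levF.
- by move=> i _; rewrite msE; apply: levS.
- move=> i i1; apply: hom_level_normal => //.
  by case: i i1 => // i _; elim: i => // i IH; apply: subset_trans IH; exact: levS.
- by move=> i _; apply: hom_level_abelian.
have ln2 : 0 < ln 2%:R :> R by rewrite ln_gt0 // ltr1n.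
apply/cvgryPge => A; near=> i.
have [sL fL] := levF _ (ms0 i); have [sL' fL'] := levF _ (ms0 i.+1).
have N0 := subgroup_index_gt0 sT sL fL.
rewrite ler_pdivlMr ?ltr0n //.
have fin : finite_index (lev (ms i)) (lev (ms i.+1)).
  by apply: sub_finite_set fL' => _ [x Lx <-]; exists x.
have := hom_level_index sH fM Hh fh0 (ms0 i) fin.
rewrite -/(lev _) -/(lev _) -msE => le.
apply: le_trans (_ : ln (q i (ms i))%:R <= _); last first.
  rewrite ler_ln ?posrE ?ltr0n ?expn_gt0 ?ler_nat //.
  by apply: leq_trans le; rewrite expn_gt0.
rewrite natrX lnXn ?ltr0n // -(mulr_natl (ln _)) natrM mulrAC ler_wpM2r //.
rewrite -ler_pdivrMr //; near: i; exact: nbhs_infty_ger.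
Unshelve. all: by end_near.
Qed.
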